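(* Let $\gamma_->2$ and $\varepsilon,p_+\in(0,1)$ be constants, and let $(p,\gamma,k)\in\Lambda_{\gamma_-,p_+}$. Then, except with probability at most $\exp(-n^{1+o(1)})$, the random graph $G(n,p)$ does not contain any family of \[\frac{(\gamma-2)(4+\varepsilon)}{1+(4\beta-1)p}\cdot\frac{pn^2}{k^4}\log n\] pairwise edge-disjoint $k$-cliques.
   Context: $G(n,p)$ is the Erdős–Rényi random graph on $\{1,\dots,n\}$; $\log$ is the natural logarithm. Let $E_p(n,k)=\binom{n}{k}p^{\binom{k}{2}}$ and $\gamma(p,n,k)=\log E_p(n,k)/\log n$. For $\gamma_->2$, $p_+\in(0,1)$, $\Lambda_{\gamma_-,p_+}$ is the family of triples of sequences $(p_n,\gamma_n,k_n)$ with $p_n\in(0,p_+)$, $\log p_n/\log n\to0$, $k_n\ge\log_{1/p_n}n$, $\gamma_n=\gamma(p_n,n,k_n)\ge\gamma_-$ for all $n$. For positive integers $n,k,t$, $\zeta(n,k,t)$ is the probability that $t$ $k$-cliques drawn uniformly and independently from the $k$-cliques of $K_n$ are pairwise edge-disjoint. Let $t_0=\frac{5(\gamma-2)}{1-p}\cdot\frac{pn^2\log n}{k^4}$, and let $\beta=\beta(n,k)$ be the maximal real number such that $\zeta(n,k,t)\le\exp(-\beta t^2k^4/n^2)$ for all $t\le t_0$. *)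

(* Defs.v *)
From HB Require Import structures.
From mathcomp Require Import all_boot all_order all_algebra.
From mathcomp Require Import all_classical all_reals all_analysis.
Set Implicit Arguments.
Unset Strict Implicit.
Unset Printing Implicit Defensive.
Import Order.TTheory GRing.Theory Num.Theory.
Import numFieldNormedType.Exports.
Local Open Scope classical_set_scope.
Local Open Scope ring_scope.

Section Graphs.
Variable n : nat.

(* A graph on the vertex set 'I_n is its set of edges, an edge being a
   two-element set of vertices; a clique is represented by its vertex set. *)
Definition clique_edges (S : {set 'I_n}) : {set {set 'I_n}} :=
  [set e : {set 'I_n} | (e \subset S) && (#|e| == 2)]%SET.

Definition complete_graph : {set {set 'I_n}} := clique_edges [set: 'I_n]%SET.

Definition cliques (G : {set {set 'I_n}}) (k : nat) : {set {set 'I_n}} :=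
  [set S : {set 'I_n} | (#|S| == k) && (clique_edges S \subset G)]%SET.

Definition edge_disjoint (S T : {set 'I_n}) : bool :=
  [disjoint clique_edges S & clique_edges T].

Definition clique_packing (G : {set {set 'I_n}}) (k : nat)
    (F : {set {set 'I_n}}) : bool :=
  (F \subset cliques G k) &&
  [forall S in F, forall T in F, (S != T) ==> edge_disjoint S T].

End Graphs.

Section Defs.
Variable R : realType.

(* Probability that the Erdos-Renyi graph G(n,p) satisfies A. *)
Definition Gnp_prob (n : nat) (p : R) (A : pred {set {set 'I_n}}) : R :=
  \sum_(G in powerset (complete_graph n) | A G)
    \prod_(e in complete_graph n) (if e \in G then p else 1 - p).

Definition expected_cliques (p : R) (n k : nat) : R :=
  'C(n, k)%:R * p ^+ 'C(k, 2).

Definition gamma_exp (p : R) (n k : nat) : R :=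
  ln (expected_cliques p n k) / ln n%:R.

(* No triple satisfies gamma_n >= gamma_- > 2 for small n (at n = 2 one has
   gamma(p,2,k) <= 1), so "for all n" means for all sufficiently large n. *)
Definition Lambda (gamma_minus p_plus : R)
    (p gamma : nat -> R) (k : nat -> nat) : Prop :=
  [/\ \forall n \near \oo, 0 < p n < p_plus,
      (ln (p n) / ln n%:R @[n --> \oo] --> (0 : R))%classic,
      \forall n \near \oo, ln n%:R / ln (p n)^-1 <= (k n)%:R,
      \forall n \near \oo, gamma n = gamma_exp (p n) n (k n) &
      \forall n \near \oo, gamma_minus <= gamma n].

Definition zeta (n k t : nat) : R :=
  #|[set f : {ffun 'I_t -> {set 'I_n}} |
      [forall i, f i \in cliques (complete_graph n) k] &&
      [forall i, forall j, (i != j) ==> edge_disjoint (f i) (f j)]]%SET|%:R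
  / (#|cliques (complete_graph n) k| ^ t)%:R.

Definition t0 (p gamma : R) (n k : nat) : R :=
  5 * (gamma - 2) / (1 - p) * (p * n%:R ^+ 2 * ln n%:R / k%:R ^+ 4).

Definition zeta_bound (p gamma : R) (n k : nat) (b : R) : Prop :=
  forall t : nat, (0 < t)%N -> t%:R <= t0 p gamma n k ->
    zeta n k t <= expR (- (b * t%:R ^+ 2 * k%:R ^+ 4 / n%:R ^+ 2)).

(* The largest b satisfying zeta_bound (0 if there is none, which can only
   happen if t0 < 1 or the parameters are degenerate). As zeta n k 1 = 1, the
   case t = 1 of zeta_bound forces b <= 0 whenever 1 <= t0. *)
Definition beta (p gamma : R) (n k : nat) : R :=
  xget 0 [set b | zeta_bound p gamma n k b /\
                  forall b', zeta_bound p gamma n k b' -> b' <= b]%classic.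

Definition packing_threshold (eps p gamma : R) (n k : nat) : R :=
  (gamma - 2) * (4 + eps) / (1 + (4 * beta p gamma n k - 1) * p)
  * (p * n%:R ^+ 2 / k%:R ^+ 4) * ln n%:R.

End Defs.

(* Main.v *)
Require Import Defs.
From HB Require Import structures.
From mathcomp Require Import all_boot all_order all_algebra.
From mathcomp Require Import all_classical all_reals all_analysis.
From mathcomp Require Import ring lra fintype finset.
Set Implicit Arguments.
Unset Strict Implicit.
Unset Printing Implicit Defensive.
Import Order.TTheory GRing.Theory Num.Theory.
Import numFieldNormedType.Exports.
Local Open Scope classical_set_scope.
Local Open Scope ring_scope.

(** Since a single random clique is trivially edge-disjoint, [beta = 0], and the
threshold is T = (4 + eps)(gamma - 2) / (1 - p) * p n^2 log n / k^4.  Put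
N = 'C(n, 2) and M = p N + 3 n^(3/2).  By a Chernoff bound, G(n,p) has more
than M edges with probability at most exp(- 2 n).  Conditionally on having
m <= M edges, a fixed packing of t >= T cliques, with s = t 'C(k, 2) edges,
is present with probability m^_s / N^_s, which is at most
(M / N)^s exp(- 'C(s, 2) (1 / M - 1 / N)).  The last factor is the gain over
p^s: there are at most (e 'C(n, k) / t)^t packings, so the union bound is
exp(t ((gamma - 2) log n - t k^4 (1 - p) / (4 p n^2) + o(log n))), and the
choice of T makes this at most exp(- 2 n) as well. *)

(** * The functions [zeta] and [beta] *)

Lemma zeta_le1 (R : realType) (n k t : nat) : zeta R n k t <= 1.
Proof.
rewrite /zeta; set C := cliques _ k; set A := (X in #|X|).
have le_AC : (#|A| <= #|C| ^ t)%N.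
  rewrite -[X in (_ <= _ ^ X)%N](card_ord t) -card_ffun_on.
  apply: subset_leq_card.
  apply/subsetP => f; rewrite inE => /andP[/forallP Cf _].
  exact/ffun_onP.
(* A zero denominator makes the quotient [0], since [0^-1 = 0]. *)
have [->|Ct0] := eqVneq (#|C| ^ t)%N 0%N; first by rewrite invr0 mulr0 ler01.
by rewrite ler_pdivrMr ?mul1r ?ler_nat // ltr0n lt0n.
Qed.

Lemma card_clique_edges (n : nat) (S : {set 'I_n}) :
  #|clique_edges S| = 'C(#|S|, 2).
Proof. exact: cards_draws. Qed.

Lemma card_complete_graph (n : nat) : #|complete_graph n| = 'C(n, 2).
Proof. by rewrite card_clique_edges cardsT card_ord. Qed.

Lemma clique_edges_sub_complete (n : nat) (S : {set 'I_n}) :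
  clique_edges S \subset complete_graph n.
Proof. by apply/subsetP => e; rewrite !inE subsetT => /andP[]. Qed.

Lemma card_cliques_complete (n k : nat) :
  #|cliques (complete_graph n) k| = 'C(n, k).
Proof.
rewrite -[X in 'C(X, _)](card_ord n) -cardsT -cards_draws; apply: eq_card => S.
by rewrite !inE subsetT clique_edges_sub_complete andbT.
Qed.

Lemma zeta1 (R : realType) (n k : nat) : (k <= n)%N -> zeta R n k 1 = 1.
Proof.
move=> le_kn; rewrite /zeta; set C := cliques _ k; set A := (X in #|X|).
have -> : #|A| = (#|C| ^ 1)%N.
  rewrite -[X in (_ ^ X)%N](card_ord 1) -card_ffun_on; apply: eq_card => f.
  rewrite inE; apply/andP/ffun_onP => [[/forallP Cf _] //|Cf]; split.
    exact/forallP.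
  by apply/forallP => i; apply/forallP => j; rewrite !ord1 eqxx.
by rewrite divff // pnatr_eq0 expn1 card_cliques_complete -lt0n bin_gt0.
Qed.

(* The constraint at [t = 1] caps the constant of [zeta_bound] at [0] as soon
   as it is not vacuous. *)
Lemma beta_eq0 (R : realType) (p gamma : R) (n k : nat) :
  (0 < k <= n)%N -> beta p gamma n k = 0.
Proof.
case/andP=> k_gt0 le_kn; rewrite /beta; case: xgetP => // b _ [zb bmax].
(* [0] is an admissible constant, so maximality gives [0 <= b]. *)
have b_ge0 : 0 <= b.
  apply: bmax => t _ _; rewrite !mul0r oppr0 expR0; exact: zeta_le1.
apply/eqP; rewrite eq_le b_ge0 andbT.
have [t0_ge1|t0_lt1] := leP 1 (t0 p gamma n k).
  have := zb 1%N isT t0_ge1; rewrite zeta1 // expr1n mulr1.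
  rewrite -[leLHS]expR0 ler_expR oppr_ge0 -mulrA pmulr_lle0 //.
  by rewrite divr_gt0 ?exprn_gt0 ?ltr0n ?(leq_trans k_gt0 le_kn).
(* For [t0 < 1] no positive [t] is constrained, so [b + 1] is admissible too, against maximality. *)
suff /bmax : zeta_bound p gamma n k (b + 1) by lra.
move=> t t_gt0 /le_lt_trans/(_ t0_lt1).
by rewrite ltrn1 ltnNge t_gt0.
Qed.

(** * Edge counts in G(n,p) and their tail *)

(* The cardinal on the left is 'C(#|K| - #|U|, m - #|U|); this form avoids
   truncated subtraction and holds for all [m]. *)
Lemma card_draws_containing (T : finType) (K U : {set T}) (m : nat) :
  U \subset K ->
  (#|[set G : {set T} | (U \subset G) && (G \subset K) && (#|G| == m)]%SET|
     * #|K| ^_ #|U| = 'C(#|K|, m) * m ^_ #|U|)%N.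
Proof.
move=> sUK; set A := (X in (#|X| * _)%N).
have le_UK := subset_leq_card sUK.
have [lt_mU|le_Um] := ltnP m #|U|.
  rewrite (ffact_small lt_mU) muln0 (eqP (_ : #|A| == 0%N)) // cards_eq0.
  apply/eqP/setP => G; rewrite !inE; apply/negP => /andP[/andP[sUG _] /eqP Gm].
  by have := subset_leq_card sUG; rewrite Gm leqNgt lt_mU.
have [lt_Km|le_mK] := ltnP #|K| m.
  rewrite (bin_small lt_Km) mul0n (eqP (_ : #|A| == 0%N)) // cards_eq0.
  apply/eqP/setP => G; rewrite !inE; apply/negP => /andP[/andP[_ sGK] /eqP Gm].
  by have := subset_leq_card sGK; rewrite Gm leqNgt lt_Km.
(* [G |-> G :\: U] is a bijection onto the subsets of [K :\: U] with [m - #|U|] elements. *)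
have -> : #|A| = 'C(#|K| - #|U|, m - #|U|).
  have {1}<- : #|K :\: U| = (#|K| - #|U|)%N by rewrite cardsD (setIidPr sUK).
  rewrite -cards_draws -(card_in_imset (f := fun G => G :\: U)) => [|G H].
    apply: eq_card => H; rewrite inE; apply/imsetP/andP => [[G]|[sH /eqP Hm]].
      rewrite inE => /andP[/andP[sUG sGK] /eqP Gm] ->.
      by rewrite setSD // cardsD (setIidPr sUG) Gm.
    have HU0 : H :&: U = set0.
      by apply: disjoint_setI0; move: sH; rewrite subsetD => /andP[].
    exists (U :|: H).
      rewrite inE subsetUl subUset sUK (subset_trans sH) ?subsetDl //=.
      by rewrite cardsU setIC HU0 cards0 subn0 Hm subnKC.
    by rewrite setDUl setDv set0U -[in LHS](setID H U) HU0 set0U.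
  rewrite !inE => /andP[/andP[sUG _] _] /andP[/andP[sUH _] _] eqGH.
  rewrite -(setID G U) -(setID H U) eqGH.
  by rewrite (setIidPr sUG) (setIidPr sUH).
(* After multiplication by this factor both sides become the factorial of [#|K|]. *)
apply/eqP; rewrite -(@eqn_pmul2r ((m - #|U|)`! * (#|K| - m)`!)%N); last first.
  by rewrite muln_gt0 !fact_gt0.
have Efact : ('C(#|K| - #|U|, m - #|U|) * ((m - #|U|)`! * (#|K| - m)`!)
    = (#|K| - #|U|)`!)%N.
  by rewrite -[RHS](@bin_fact _ (m - #|U|)) ?leq_sub2r // subnBA // subnK.
rewrite mulnAC Efact mulnC ffact_fact // -(bin_fact le_mK) -(ffact_fact le_Um).
by rewrite !mulnA.
Qed.

Lemma Gnp_weight (R : realType) (T : finType) (p : R) (K G : {set T}) :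
  G \subset K ->
  \prod_(e in K) (if e \in G then p else 1 - p) =
  p ^+ #|G| * (1 - p) ^+ (#|K| - #|G|).
Proof.
move=> sGK; rewrite (big_setID G) /= (setIidPr sGK); congr (_ * _).
  by rewrite -prodr_const; apply: eq_bigr => e ->.
have -> : (#|K| - #|G|)%N = #|K :\: G| by rewrite cardsD (setIidPr sGK).
rewrite -prodr_const; apply: eq_bigr => e.
by rewrite inE => /andP[/negbTE ->].
Qed.

(** Graphs with equally many edges have equal weight. The predicate [Q] on the edge count serves
    twice: few edges for the packings and, with [U = set0], many edges for the tail. *)
Lemma Gnp_prob_contains (R : realType) (n : nat) (p : R)
    (U : {set {set 'I_n}}) (Q : pred nat) :
  let K := complete_graph n in
  Gnp_prob p (fun G => (U \subset G) && Q #|G|) =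
  \sum_(m < #|K|.+1 | Q m)
    #|[set G : {set {set 'I_n}} |
        (U \subset G) && (G \subset K) && (#|G| == m)]%SET|%:R
    * (p ^+ m * (1 - p) ^+ (#|K| - m)).
Proof.
move=> K; rewrite /Gnp_prob -/K.
rewrite (partition_big (fun G : {set {set 'I_n}} => inord #|G| : 'I_#|K|.+1)
  (fun m : 'I_#|K|.+1 => Q m)) /=; last first.
  move=> G /andP[]; rewrite powersetE => sGK /andP[_].
  by rewrite inordK // ltnS subset_leq_card.
apply: eq_bigr => m Qm; rewrite mulr_natl -sumr_const; apply: eq_big.
  move=> G; rewrite powersetE inE.
  have [sGK|] := boolP (G \subset K); last by rewrite andbF.
  rewrite -val_eqE /= inordK ?ltnS ?subset_leq_card // andbT.
  by case: eqP => [->|]; rewrite ?andbF // Qm !andbT.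
move=> G /andP[/andP[]]; rewrite powersetE => sGK _ /eqP <-.
by rewrite Gnp_weight // inordK // ltnS subset_leq_card.
Qed.

(** Conditioned on having [m] edges the graph is uniform and contains [U] with probability
    [m ^_ #|U| / #|K| ^_ #|U|]. A bound [rho] on these ratios survives averaging over the binomial
    law of [m]. *)
Lemma Gnp_prob_contains_le (R : realType) (n : nat) (p rho : R)
    (U : {set {set 'I_n}}) (Q : pred nat) :
  let K := complete_graph n in
  0 <= p <= 1 -> 0 <= rho -> U \subset K ->
  (forall m, Q m -> (m ^_ #|U|)%:R <= (#|K| ^_ #|U|)%:R * rho) ->
  Gnp_prob p (fun G => (U \subset G) && Q #|G|) <= rho.
Proof.
move=> K /andP[p_ge0 p_le1] rho_ge0 sUK Qrho; rewrite Gnp_prob_contains -/K.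
have -> : rho = \sum_(m < #|K|.+1)
    rho * ('C(#|K|, m)%:R * (p ^+ m * (1 - p) ^+ (#|K| - m))).
  rewrite -mulr_sumr -[LHS]mulr1; congr (_ * _).
  rewrite -[LHS](expr1n _ #|K|) -[X in X ^+ _](subrK p) exprDn.
  by apply: eq_bigr => m _; rewrite -mulr_natl [_ ^+ m * _]mulrC.
rewrite big_mkcond; apply: ler_sum => m _.
have w_ge0 : 0 <= p ^+ m * (1 - p) ^+ (#|K| - m).
  by rewrite mulr_ge0 ?exprn_ge0 ?subr_ge0.
case: ifP => [Qm|_]; last by rewrite mulr_ge0 // mulr_ge0.
rewrite [leRHS]mulrA ler_wpM2r //.
have K_gt0 : 0 < (#|K| ^_ #|U|)%:R :> R.
  by rewrite ltr0n ffact_gt0 subset_leq_card.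
rewrite -(ler_pM2r K_gt0) -natrM card_draws_containing // natrM.
by rewrite [rho * _]mulrC -mulrA ler_wpM2l // mulrC Qrho.
Qed.

(** Exponential Markov inequality: the edge count has moment generating function
    [(1 - p + p * expR lam) ^+ #|K|]. *)
Lemma Gnp_prob_chernoff (R : realType) (n : nat) (p M lam : R) :
  let N := #|complete_graph n|%:R in
  0 <= p <= 1 -> 0 <= lam <= 2^-1 ->
  Gnp_prob p (fun G : {set {set 'I_n}} => M < #|G|%:R) <=
  expR (p * N * (lam + 2 * lam ^+ 2) - lam * M).
Proof.
move=> N /andP[p_ge0 p_le1] /andP[lam_ge0 lam_le]; set K := complete_graph n.
have -> : Gnp_prob p (fun G : {set {set 'I_n}} => M < #|G|%:R) =
    Gnp_prob p (fun G : {set {set 'I_n}} =>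
      (set0 \subset G) && (fun m => M < m%:R) #|G|).
  by apply: eq_bigl => G; rewrite sub0set.
rewrite (Gnp_prob_contains p set0 (fun m => M < m%:R)) -/K.
apply: (@le_trans _ _ (\sum_(m < #|K|.+1) expR (- (lam * M)) *
    ('C(#|K|, m)%:R * ((p * expR lam) ^+ m * (1 - p) ^+ (#|K| - m))))).
  rewrite big_mkcond; apply: ler_sum => m _.
  have w_ge0 : 0 <= p ^+ m * (1 - p) ^+ (#|K| - m).
    by rewrite mulr_ge0 ?exprn_ge0 ?subr_ge0.
  have := card_draws_containing m (sub0set K).
  rewrite cards0 !ffactn0 !muln1 => ->.
  case: ifP => [Mm|_]; last first.
    by rewrite !mulr_ge0 ?expR_ge0 ?exprn_ge0 ?mulr_ge0 ?expR_ge0 ?subr_ge0.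
  have -> : expR (- (lam * M)) *
      ('C(#|K|, m)%:R * ((p * expR lam) ^+ m * (1 - p) ^+ (#|K| - m))) =
      'C(#|K|, m)%:R *
      (expR (lam * (m%:R - M)) * (p ^+ m * (1 - p) ^+ (#|K| - m))).
    rewrite exprMn -expRM_natr mulrBr expRD; move: ((1 - p) ^+ _) => q.
    by move: (expR _) (expR _) (p ^+ m) _%:R => x y z c; ring.
  rewrite ler_wpM2l // ler_peMl //; apply: le_trans (expR_ge1Dx _).
  by rewrite lerDl mulr_ge0 // subr_ge0 ltW.
rewrite -mulr_sumr.
have -> : \sum_(m < #|K|.+1)
    'C(#|K|, m)%:R * ((p * expR lam) ^+ m * (1 - p) ^+ (#|K| - m)) =
    (1 - p + p * expR lam) ^+ #|K|.
  rewrite exprDn; apply: eq_bigr => m _.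
  by rewrite -[RHS]mulr_natl; congr (_ * _); exact: mulrC.
rewrite addrC expRD [leRHS]mulrC ler_wpM2l ?expR_ge0 //.
have -> : p * N * (lam + 2 * lam ^+ 2) = (p * (lam + 2 * lam ^+ 2)) * N by ring.
rewrite expRM_natr; apply: lerXn2r; rewrite ?nnegrE ?expR_ge0 //.
  by rewrite addr_ge0 ?subr_ge0 // mulr_ge0 ?expR_ge0.
apply: le_trans (expR_ge1Dx _).
(* This follows from [(1 - lam) * expR lam <= 1], because [(1 - lam) * (1 + lam + 2 * lam ^+ 2) >=
   1] when [lam <= 1/2]. *)
suff : expR lam <= 1 + lam + 2 * lam ^+ 2 by nra.
have := expR_ge1Dx (- lam); rewrite expRN => e_ge.
have e_gt0 := expR_gt0 lam.
have : (1 - lam) * expR lam <= 1.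
  by rewrite -ler_pdivlMr // div1r.
nra.
Qed.

Lemma Gnp_prob_union (R : realType) (n : nat) (I : finType) (p : R)
    (P Q : pred {set {set 'I_n}}) (D : {set I})
    (B : I -> pred {set {set 'I_n}}) :
  0 <= p <= 1 ->
  (forall G, P G -> Q G \/ exists2 i, i \in D & B i G) ->
  Gnp_prob p P <= Gnp_prob p Q + \sum_(i in D) Gnp_prob p (B i).
Proof.
case/andP=> p_ge0 p_le1 PQB; rewrite /Gnp_prob.
under [X in _ <= _ + X]eq_bigr => i _ do rewrite big_mkcondr.
rewrite exchange_big /= !big_mkcondr -big_split /=.
apply: ler_sum => G _; set w := \prod_(e in _) _.
have w_ge0 : 0 <= w by apply: prodr_ge0 => e _; case: ifP; rewrite ?subr_ge0.
have s_ge0 : 0 <= \sum_(i in D) (if B i G then w else 0).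
  by apply: sumr_ge0 => i _; case: ifP.
case: ifP => [/PQB[->|[i Di BiG]]|_].
- by rewrite lerDl.
- rewrite (bigD1 i) //= BiG addrCA lerDl addr_ge0 //; first by case: ifP.
  by apply: sumr_ge0 => j _; case: ifP.
- by rewrite addr_ge0 //; case: ifP.
Qed.

Lemma Gnp_prob_sub (R : realType) (n : nat) (p : R)
    (P Q : pred {set {set 'I_n}}) :
  0 <= p <= 1 -> (forall G, P G -> Q G) -> Gnp_prob p P <= Gnp_prob p Q.
Proof.
move=> p01 PQ.
have := @Gnp_prob_union R n unit p P Q set0 (fun=> xpred0) p01.
by rewrite big_set0 addr0; apply=> G /PQ; left.
Qed.

(** * Packings and the union bound *)

Lemma card_packing_edges (n k : nat) (G F : {set {set 'I_n}}) :
  clique_packing G k F ->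
  #|\bigcup_(S in F) clique_edges S|%SET = (#|F| * 'C(k, 2))%N.
Proof.
case/andP=> /subsetP sFG /forall_inP dF.
(* Sets outside [F] contribute [set0], which gives a union over all [S] of pairwise disjoint
   sets. *)
have -> : (\bigcup_(S in F) clique_edges S = 
    \bigcup_S (if S \in F then clique_edges S else set0))%SET.
  by rewrite big_mkcond.
rewrite -sum1_card partition_disjoint_bigcup /=; last first.
  move=> S T neqST; case: ifP => FS; last by rewrite -setI_eq0 set0I.
  case: ifP => FT; last by rewrite -setI_eq0 setI0.
  by have /forall_inP/(_ T FT)/implyP/(_ neqST) := dF S FS.
rewrite -sum_nat_const [RHS]big_mkcond; apply: eq_bigr => S _.
rewrite sum1_card; case: ifP => FS; last by rewrite cards0.
by have := sFG S FS; rewrite inE card_clique_edges => /andP[/eqP ->].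
Qed.

Lemma clique_packing_sub (n k : nat) (G F F' : {set {set 'I_n}}) :
  F' \subset F -> clique_packing G k F -> clique_packing G k F'.
Proof.
move=> /subsetP sFF /andP[sFG /forall_inP dF]; apply/andP; split.
  by apply: subset_trans sFG; apply/subsetP.
apply/forall_inP => S /sFF FS; apply/forall_inP => T /sFF FT.
by have /forall_inP/(_ T FT) := dF S FS.
Qed.

Lemma exists_subset_card (T : finType) (A : {set T}) (t : nat) :
  (t <= #|A|)%N -> exists2 B : {set T}, B \subset A & #|B| = t.
Proof.
move=> le_tA; have : (0 < 'C(#|A|, t))%N by rewrite bin_gt0.
rewrite -cards_draws card_gt0 => /set0Pn[B]; rewrite inE => /andP[sBA /eqP Bt].
by exists B.
Qed.

(** If [G] has at most [M] edges, some [t] cliques of the family form a packing of the complete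
    graph whose [s] edges all lie in [G]. For a fixed packing this has probability at most [rho], by
    the hypothesis on falling factorials. *)
Lemma Gnp_prob_packing_le (R : realType) (n k t : nat) (p M rho : R) :
  let N := 'C(n, 2) in let s := (t * 'C(k, 2))%N in
  0 <= p <= 1 -> 0 <= rho ->
  (forall m : nat, m%:R <= M -> (m ^_ s)%:R <= (N ^_ s)%:R * rho) ->
  Gnp_prob p (fun G : {set {set 'I_n}} =>
    [exists F : {set {set 'I_n}}, clique_packing G k F && (t <= #|F|)%N]) <=
  Gnp_prob p (fun G : {set {set 'I_n}} => M < #|G|%:R)
    + 'C('C(n, k), t)%:R * rho.
Proof.
move=> N s p01 rho_ge0 Hrho.
pose E (F : {set {set 'I_n}}) := (\bigcup_(S in F) clique_edges S)%SET.
pose D := [set F : {set {set 'I_n}} |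
  clique_packing (complete_graph n) k F && (#|F| == t)]%SET.
apply: le_trans (@Gnp_prob_union _ _ _ p _ (fun G => M < #|G|%:R) D
  (fun F G => (E F \subset G) && (#|G|%:R <= M)) p01 _) _.
  move=> G /existsP[F /andP[packF le_tF]].
  have [le_GM|lt_MG] := leP #|G|%:R M; [right|by left].
  (* Trimming to exactly [t] cliques fixes the number of edges at [s]. *)
  have [F' sF'F F't] := exists_subset_card le_tF.
  have /andP[/subsetP sF'G dF'] := clique_packing_sub sF'F packF.
  exists F'; last first.
    apply/andP; split=> //; apply/bigcupsP => S /sF'G.
    by rewrite inE => /andP[].
  rewrite inE F't eqxx andbT; apply/andP; split=> //; apply/subsetP => S /sF'G.
  by rewrite !inE clique_edges_sub_complete andbT => /andP[].
rewrite lerD2l; apply: (@le_trans _ _ (\sum_(F in D) rho)).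
  apply: ler_sum => F; rewrite inE => /andP[packF /eqP Ft].
  apply: (Gnp_prob_contains_le p01 rho_ge0 (Q := fun m => m%:R <= M)).
    by apply/bigcupsP => S _; exact: clique_edges_sub_complete.
  by move=> m; rewrite (card_packing_edges packF) Ft
    card_complete_graph; exact: Hrho.
rewrite sumr_const -[leLHS]mulr_natl ler_wpM2r // ler_nat.
rewrite -(card_cliques_complete n k) -cards_draws.
apply: subset_leq_card; apply/subsetP => F; rewrite !inE => /andP[].
by case/andP=> ->.
Qed.

(** * Falling factorials and binomial coefficients *)

(* Factor by factor: (M - i) / (N - i) <= (M / N) exp(- i (1 / M - 1 / N)). *)
Lemma ffact_ratio_le (R : realType) (m N s : nat) (M : R) :
  0 < M -> m%:R <= M -> M <= N%:R ->
  (m ^_ s)%:R <= (N ^_ s)%:R *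
    ((M / N%:R) ^+ s * expR (- ('C(s, 2)%:R * (M^-1 - N%:R^-1)))).
Proof.
move=> M_gt0 le_mM le_MN.
have N_gt0 : 0 < N%:R :> R by exact: lt_le_trans le_MN.
elim: s => [|s IHs].
  by rewrite !ffactn0 expr0 bin0n mul0r oppr0 expR0 !mulr1.
have [le_ms|lt_sm] := leqP m s.
  rewrite (ffact_small (n := m)) ?ltnS // !mulr_ge0 ?expR_ge0 ?exprn_ge0 //.
  by rewrite divr_ge0 // ltW.
have lt_sM : s%:R < M by apply: lt_le_trans le_mM; rewrite ltr_nat.
have lt_sN : (s < N)%N by rewrite -(ltr_nat R) (lt_le_trans lt_sM).
have step : m%:R - s%:R <=
    (N%:R - s%:R) * (M / N%:R * expR (- (s%:R * (M^-1 - N%:R^-1)))).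
  have sN_gt0 : 0 < N%:R - s%:R :> R by rewrite subr_gt0 ltr_nat.
  apply: (@le_trans _ _ (M - s%:R)); first by rewrite lerB.
  (* The exponential is linearised by [1 - x <= exp(-x)]; what is left over is exactly
     [s^2 (N - M) / N^2]. *)
  apply: (@le_trans _ _ ((N%:R - s%:R) * (M / N%:R *
      (1 - s%:R * (M^-1 - N%:R^-1))))); last first.
    rewrite ler_wpM2l ?(ltW sN_gt0) // ler_wpM2l ?divr_ge0 ?(ltW M_gt0) //.
    exact: expR_ge1Dx.
  rewrite -subr_ge0.
  have -> : (N%:R - s%:R) * (M / N%:R * (1 - s%:R * (M^-1 - N%:R^-1)))
      - (M - s%:R) = s%:R ^+ 2 * (N%:R - M) / N%:R ^+ 2.
    by field; rewrite !gt_eqF.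
  by rewrite divr_ge0 ?mulr_ge0 ?exprn_ge0 ?subr_ge0.
rewrite !ffactnSr !natrM !natrB ?(ltnW lt_sN) ?(ltnW lt_sm) //.
have -> : 'C(s.+1, 2) = ('C(s, 2) + s)%N by rewrite binS bin1 addnC addnC.
rewrite natrD mulrDl opprD expRD exprS.
set a := _ ^+ s in IHs *; set b := expR _ in IHs *.
have sm_ge0 : 0 <= m%:R - s%:R :> R by rewrite subr_ge0 ler_nat ltnW.
apply: le_trans (ler_pM _ sm_ge0 IHs step) _ => //.
by rewrite le_eqVlt; apply/orP; left; apply/eqP; ring.
Qed.

Lemma ffact_le_expn (a u : nat) : (a ^_ u <= a ^ u)%N.
Proof.
elim: u => [//|u IHu].
by rewrite ffactnSr expnSr leq_mul // leq_subr.
Qed.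

(** The bound [(e a / t)^t] in logarithmic form; it comes from keeping a single term of the
    exponential series, [t^t / t! <= e^t]. *)
Lemma bin_le_expR (R : realType) (a t : nat) : (0 < a)%N -> (0 < t)%N ->
  'C(a, t)%:R <= expR (t%:R * (1 + ln a%:R - ln t%:R)) :> R.
Proof.
case: t => [//|t] a_gt0 _; set u := t.+1.
have u_gt0 : 0 < u%:R :> R by rewrite ltr0n.
have fact_ge : u%:R ^+ u <= expR u%:R * u`!%:R :> R.
  rewrite -ler_pdivrMr ?ltr0n ?fact_gt0 //.
  by apply: le_trans (expR_ge1Dxn t (ltW u_gt0)); rewrite lerDr.
rewrite mulrBr mulrDr mulr1 expRD expRN expRD !expRM_natl !lnK ?posrE ?ltr0n //.
rewrite ler_pdivlMr ?exprn_gt0 //.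
apply: (@le_trans _ _ ('C(a, u)%:R * (expR u%:R * u`!%:R))).
  by rewrite ler_wpM2l.
rewrite mulrCA ler_wpM2l ?expR_ge0 // -natrM bin_ffact -natrX ler_nat.
exact: ffact_le_expn.
Qed.

Lemma natr_bin2 (R : realType) (s : nat) :
  'C(s, 2)%:R = s%:R * (s%:R - 1) / 2 :> R.
Proof.
elim: s => [|s IHs]; first by rewrite bin0n !mul0r.
by rewrite binS bin1 natrD IHs -natr1; field.
Qed.

(** * Edge tail and exponent of the union bound *)

(** The Chernoff parameter is [n^(-1/2)], at most [1/2] for [n >= 4]; the exponent is then
    [p (n - 1) - 3 n]. *)
Lemma edges_tail_le (R : realType) (n : nat) (p : R) :
  (4 <= n)%N -> 0 <= p <= 1 ->
  Gnp_prob p (fun G : {set {set 'I_n}} =>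
    p * 'C(n, 2)%:R + 3 * Num.sqrt n%:R ^+ 3 < #|G|%:R) <= expR (- (2 * n%:R)).
Proof.
move=> n_ge4 p01; set r := Num.sqrt n%:R.
have r2 : r ^+ 2 = n%:R by rewrite sqr_sqrtr.
have r_ge2 : 2 <= r.
  have : 4 <= n%:R :> R by rewrite ler_nat.
  have : 0 <= r by exact: sqrtr_ge0.
  rewrite -r2; nra.
have r_gt0 : 0 < r by lra.
have lam01 : 0 <= r^-1 <= 2^-1.
  by rewrite invr_ge0 ltW //= lef_pV2 ?posrE.
apply: le_trans (Gnp_prob_chernoff _ _ p01 lam01) _.
rewrite ler_expR card_complete_graph natr_bin2 -r2.
have [p_ge0 p_le1] := andP p01.
have -> : p * (r ^+ 2 * (r ^+ 2 - 1) / 2) * (r^-1 + 2 * r^-1 ^+ 2)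
   - r^-1 * (p * (r ^+ 2 * (r ^+ 2 - 1) / 2) + 3 * r ^+ 3)
   = p * (r ^+ 2 - 1) - 3 * r ^+ 2 by field; rewrite gt_eqF.
nra.
Qed.

(** Three estimates are multiplied: [bin_le_expR] for the number of families, [1 + eta <= exp eta]
    for the power, and [1 / (1 + eta) >= 1 - eta] for the gain. The terms [ln 'C(n, k) + c * ln p]
    stay together because they make up [gamma log n]. *)
Lemma packing_count_le (R : realType) (n k t : nat) (p eta : R) :
  let N : R := 'C(n, 2)%:R in let c := 'C(k, 2)%:R in
  let s := (t * 'C(k, 2))%N in let M := p * N * (1 + eta) in
  (0 < t)%N -> (k <= n)%N -> 0 < N -> 0 < p -> 0 <= eta ->
  'C('C(n, k), t)%:R *
    ((M / N) ^+ s * expR (- ('C(s, 2)%:R * (M^-1 - N^-1)))) <=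
  expR (t%:R * (1 + (ln 'C(n, k)%:R + c * ln p) - ln t%:R + c * eta
    - (t%:R * c - 1) * c / 2 * (1 - p - eta) / (p * N))).
Proof.
move=> N c s M t_gt0 le_kn N_gt0 p_gt0 eta_ge0.
have pow_le : (M / N) ^+ s <= expR (t%:R * (c * ln p + c * eta)).
  have -> : M / N = p * (1 + eta) by rewrite /M; field; rewrite gt_eqF.
  have -> : t%:R * (c * ln p + c * eta) = s%:R * (ln p + eta).
    by rewrite /s natrM /c; ring.
  rewrite expRM_natl; apply: lerXn2r; rewrite ?nnegrE ?expR_ge0 //.
    by rewrite mulr_ge0 ?(ltW p_gt0) // addr_ge0.
  by rewrite expRD lnK ?posrE // ler_wpM2l ?(ltW p_gt0) // expR_ge1Dx.
have exp_le : expR (- ('C(s, 2)%:R * (M^-1 - N^-1))) <=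
    expR (t%:R * - ((t%:R * c - 1) * c / 2 * (1 - p - eta) / (p * N))).
  rewrite ler_expR mulrN lerN2 natr_bin2.
  have pN_gt0 : 0 < p * N by rewrite mulr_gt0.
  have -> : t%:R * ((t%:R * c - 1) * c / 2 * (1 - p - eta) / (p * N))
     = s%:R * (s%:R - 1) / 2 * ((1 - p - eta) / (p * N)).
    by rewrite /s natrM -/c; field; rewrite !gt_eqF.
  apply: ler_wpM2l.
    by rewrite -natr_bin2.
  have -> : M^-1 - N^-1 = ((1 + eta)^-1 - p) / (p * N).
    by rewrite /M; field; rewrite !gt_eqF //; lra.
  rewrite ler_wpM2r ?invr_ge0 ?(ltW pN_gt0) // addrAC lerD2r.
  rewrite -[leRHS]mul1r ler_pdivlMr; last by lra.
  nra.
have cnt_le := bin_le_expR R (_ : 0 < 'C(n, k))%N t_gt0.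
rewrite bin_gt0 in cnt_le; have {}cnt_le := cnt_le le_kn.
set A := 'C('C(n, k), t)%:R in cnt_le *.
set B := _ ^+ s in pow_le *; set E := expR _ in exp_le *.
have -> : t%:R * (1 + (ln 'C(n, k)%:R + c * ln p) - ln t%:R + c * eta
    - (t%:R * c - 1) * c / 2 * (1 - p - eta) / (p * N)) =
  t%:R * (1 + ln 'C(n, k)%:R - ln t%:R) + (t%:R * (c * ln p + c * eta) +
   t%:R * - ((t%:R * c - 1) * c / 2 * (1 - p - eta) / (p * N))).
  set w := _ / (p * N); ring.
rewrite expRD expRD; have B_ge0 : 0 <= B.
  by rewrite exprn_ge0 // divr_ge0 ?(ltW N_gt0) // !mulr_ge0 ?ltW //; lra.
rewrite ler_pM // ?mulr_ge0 ?expR_ge0 //.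
by rewrite ler_pM // expR_ge0.
Qed.

(** If [k > n], the conventions ['C(n, k) = 0] and [ln 0 = 0] give exponent [0]. The logarithmic
    bound on [k] holds because ['C(n, k) <= n^k] must outweigh [p^(k (k - 1) / 2)]. *)
Lemma gamma_clique_size (R : realType) (p q : R) (n k : nat) :
  0 < p < q -> q < 1 -> 0 < ln n%:R :> R -> (0 < k)%N ->
  0 < gamma_exp p n k ->
  [/\ (k <= n)%N, k%:R <= 1 + 2 / (- ln q) * ln n%:R &
    ln 'C(n, k)%:R + 'C(k, 2)%:R * ln p = gamma_exp p n k * ln n%:R].
Proof.
move=> /andP[p_gt0 lt_pq] q_lt1 L_gt0 k_gt0 gam_gt0.
set L := ln n%:R in L_gt0 *.
have q_gt0 := lt_trans p_gt0 lt_pq.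
have lnq_lt0 : ln q < 0 by rewrite -ln1 ltr_ln ?posrE.
have lnp_le : ln p <= ln q by rewrite ler_ln ?posrE // ltW.
have le_kn : (k <= n)%N.
  rewrite leqNgt; apply/negP => lt_nk; move: gam_gt0.
  by rewrite /gamma_exp /expected_cliques bin_small // mul0r ln0 // mul0r ltxx.
have C_gt0 : 0 < 'C(n, k)%:R :> R by rewrite ltr0n bin_gt0.
have gamE : ln 'C(n, k)%:R + 'C(k, 2)%:R * ln p = gamma_exp p n k * L.
  rewrite /gamma_exp /expected_cliques divfK ?gt_eqF //.
  by rewrite lnM ?posrE ?exprn_gt0 // lnXn // mulr_natl.
split=> //.
have n_gt0 : (0 < n)%N by exact: leq_trans le_kn.
have lnC_le : ln 'C(n, k)%:R <= k%:R * L.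
  have -> : k%:R * L = ln (n%:R ^+ k) by rewrite lnXn ?ltr0n // mulr_natl.
  rewrite ler_ln ?posrE ?exprn_gt0 ?ltr0n ?bin_gt0 // -natrX ler_nat.
  apply: (@leq_trans ('C(n, k) * k`!)); first by rewrite leq_pmulr // fact_gt0.
  by rewrite bin_ffact ffact_le_expn.
have k_ge1 : 1 <= k%:R :> R by rewrite ler1n.
have key : (k%:R - 1) * - ln q <= 2 * L.
  have := mulr_gt0 gam_gt0 L_gt0; rewrite -gamE natr_bin2 => gam_ge0.
  have : 0 <= k%:R * (2 * L - (k%:R - 1) * - ln q).
    have : 0 <= k%:R * (k%:R - 1) * (ln q - ln p).
      by rewrite !mulr_ge0 // ?subr_ge0.
    nra.
  by rewrite pmulr_rge0 ?subr_ge0 // ltr0n.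
have : k%:R - 1 <= 2 * L / - ln q.
  by rewrite ler_pdivlMr // oppr_gt0.
have -> : 2 / - ln q * L = 2 * L / - ln q by ring.
lra.
Qed.

(** Here [g] is [gamma - 2] and [lnt] is [ln t], which cancels the [2 * L] up to [5 * tau * L]. The
    quadratic gain exceeds the remaining [g * L] by a factor close to [1 + eps / 4]. *)
Lemma packing_exponent_le (R : realType)
    (p eps g g0 tau L N c t eta lnt : R) :
  0 < p < 1 -> 0 < N -> 0 <= c -> 0 <= t -> 0 <= eta <= tau * (1 - p) ->
  0 < eps < 1 -> 0 < g0 <= g -> 0 < tau ->
  30 * tau <= eps -> 128 * tau <= g0 * eps ->
  1 <= tau * L -> c * eta <= tau * L -> c / (2 * (p * N)) <= tau * L ->
  (2 - 5 * tau) * L <= lnt ->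
  (1 + eps / 4) * (1 - 2 * tau) * (g * L)
    <= t * c ^+ 2 / (2 * (p * N)) * (1 - p) ->
  1 + (g + 2) * L - lnt + c * eta
    - (t * c - 1) * c / 2 * (1 - p - eta) / (p * N) <= - (g0 * eps / 16 * L).
Proof.
move=> /andP[p_gt0 p_lt1] N_gt0 c_ge0 t_ge0 /andP[eta_ge0 eta_le].
move=> /andP[eps_gt0 eps_lt1] /andP[g0_gt0 le_g0g] tau_gt0 tau_eps tau_g0.
move=> tauL ceta_le cN_le lnt_ge main.
have L_gt0 : 0 < L by rewrite -(pmulr_rgt0 _ tau_gt0); lra.
have pN_gt0 : 0 < 2 * (p * N) by rewrite !mulr_gt0.
have -> : (t * c - 1) * c / 2 * (1 - p - eta) / (p * N) =
    (t * c ^+ 2 / (2 * (p * N)) - c / (2 * (p * N))) * (1 - p - eta).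
  by field; rewrite !gt_eqF.
(* [W] carries the gain; [V] is the loss from [s - 1] in place of [s] in ['C(s, 2)]. *)
set W := t * c ^+ 2 / _ in main *; set V := c / _ in cN_le *.
have W_ge0 : 0 <= W by rewrite divr_ge0 ?mulr_ge0 ?exprn_ge0 // ltW.
have V_ge0 : 0 <= V by rewrite divr_ge0 // ltW.
have V_le : V * (1 - p - eta) <= tau * L.
  apply: le_trans cN_le; rewrite ler_piMr //; lra.
have W_ge : W * (1 - p) * (1 - tau) <= W * (1 - p - eta).
  by rewrite -mulrA ler_wpM2l //; nra.
have gL_gt0 : 0 < g * L by rewrite mulr_gt0 //; lra.
have W_main : (1 + eps / 4) * (1 - 3 * tau) * (g * L)
    <= W * (1 - p) * (1 - tau).
  have tau1 : 0 <= 1 - tau by lra.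
  apply: le_trans (ler_wpM2r tau1 main).
  have : 0 <= (1 + eps / 4) * (g * L) * (2 * tau ^+ 2).
    by rewrite !mulr_ge0 ?exprn_ge0 //; lra.
  lra.
have small : (1 + eps / 8) * (g * L) <= (1 + eps / 4) * (1 - 3 * tau) * (g * L).
  by rewrite ler_wpM2r ?(ltW gL_gt0) //; nra.
have g0L : g0 * L <= g * L by rewrite ler_wpM2r // ltW.
have tauL_le : 128 * (tau * L) <= g0 * eps * L.
  by rewrite mulrA ler_wpM2r // ltW.
have epsg : g0 * eps * L <= eps * (g * L).
  by rewrite [g0 * eps]mulrC -mulrA ler_wpM2l // ltW.
(* The errors add up to [8 * tau * L <= g0 * eps * L / 16], half of the surplus [eps / 8 * g * L] or
   less. *)
lra.
Qed.

(** * The bound for a fixed [n] *)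

Lemma exists_nat_ceil (R : realType) (x : R) :
  exists t : nat, x <= t%:R /\ forall m : nat, x <= m%:R -> (t <= m)%N.
Proof.
have ex_t : exists t : nat, x <= t%:R.
  by exists (Num.truncn x).+1; rewrite ltW // truncnS_gt.
by exists (ex_minn ex_t); case: ex_minnP.
Qed.

(** Every requirement that [n] be large is an explicit inequality here, so no limits enter the
    argument. *)
Lemma packing_prob_le (R : realType) (eps tau q g0 p : R) (n k : nat) :
  let L : R := ln n%:R in let gamma := gamma_exp p n k in
  0 < eps < 1 -> 0 < g0 -> g0 <= gamma - 2 -> 0 < tau ->
  30 * tau <= eps -> 128 * tau <= g0 * eps ->
  0 < p < q -> q < 1 -> - ln p <= tau * L -> 1 <= tau * k%:R ->
  (4 <= n)%N -> 1 <= tau * L -> 1 <= 4 * (g0 * L) -> 32 <= g0 * eps * L ->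
  12 * expR (- (L / 4)) <= tau * (1 - q) ->
  1 + 2 / (- ln q) * L <= expR (tau * L) ->
  Gnp_prob p (fun G : {set {set 'I_n}} =>
    [exists F : {set {set 'I_n}}, clique_packing G k F &&
       (packing_threshold eps p gamma n k <= #|F|%:R)]) <= expR (- n%:R).
Proof.
move=> L gamma /[dup] heps /andP[eps_gt0 eps_lt1] g0_gt0 g0_le tau_gt0.
move=> tau_eps tau_g0 /[dup] hpq /andP[p_gt0 lt_pq] q_lt1 lnp_ge tauk n_ge4.
move=> tauL g0L g0epsL expL_le klogL.
have p_lt1 : p < 1 by exact: lt_trans q_lt1.
have p01 : 0 <= p <= 1 by rewrite !ltW.
have L_gt0 : 0 < L by rewrite -(pmulr_rgt0 _ tau_gt0); lra.
have k_gt0 : (0 < k)%N.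
  by rewrite -(ltr0n R) -(pmulr_rgt0 _ tau_gt0); lra.
have [|le_kn k_le gammaE] := @gamma_clique_size _ p q n k hpq q_lt1 L_gt0 k_gt0.
  rewrite -/gamma; lra.
have n_gt0 : 0 < n%:R :> R by rewrite ltr0n (leq_trans _ n_ge4).
rewrite /packing_threshold beta_eq0 ?k_gt0 // mulr0 add0r mulN1r.
set T := _ * L.
have [t [le_Tt t_min]] := exists_nat_ceil T.
set g := gamma - 2 in g0_le T le_Tt t_min *.
set kr : R := k%:R in tauk k_le T le_Tt t_min *.
have kr_ge1 : 1 <= kr by rewrite ler1n.
(* [y = n^tau] bounds both [k] and [1 / p]. *)
set y := expR (tau * L) in klogL.
have y_gt0 : 0 < y by exact: expR_gt0.
have k_le_y : kr <= y by apply: le_trans klogL.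
have pV_le : p^-1 <= y.
  by rewrite -[p]lnK ?posrE // -expRN ler_expR.
pose r := Num.sqrt n%:R : R.
have r2 : r ^+ 2 = n%:R by rewrite sqr_sqrtr // ltW.
have r_gt0 : 0 < r by rewrite sqrtr_gt0.
have r2_ge4 : 4 <= r ^+ 2 by rewrite r2 ler_nat.
have r_ge2 : 2 <= r by nra.
have nE : expR L = n%:R by rewrite lnK ?posrE.
have rE : r = expR (L / 2).
  apply/eqP; rewrite -(@eqrXn2 _ 2) ?expR_ge0 ?(ltW r_gt0) // r2 -expRM_natl.
  by rewrite mulrC divfK ?pnatr_eq0 // nE.
have NE : 'C(n, 2)%:R = r ^+ 2 * (r ^+ 2 - 1) / 2 :> R by rewrite natr_bin2 r2.
set N : R := 'C(n, 2)%:R in NE.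
have N_gt0 : 0 < N by rewrite NE !mulr_gt0 ?exprn_gt0 ?invr_gt0 //; lra.
have pN_gt0 : 0 < p * N by rewrite mulr_gt0.
set c : R := 'C(k, 2)%:R in gammaE.
have cE : c = kr * (kr - 1) / 2 by rewrite /c natr_bin2.
have c_ge0 : 0 <= c by rewrite ler0n.
(* Chosen so that [p * N * (1 + eta)] is the edge bound of [edges_tail_le]. *)
pose eta := 3 * r ^+ 3 / (p * N).
have eta_ge0 : 0 <= eta by rewrite divr_ge0 ?mulr_ge0 ?exprn_ge0 // ltW.
(* The left side is at most [12 n^(3 tau - 1/2)], hence at most [12 n^(-1/4)] as [tau <= 1/30]. *)
have keta_le : kr ^+ 2 * eta <= tau * (1 - q).
  apply: le_trans expL_le.
  have eta_le : eta <= 12 * (p^-1 / r).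
    rewrite /eta ler_pdivrMr // NE.
    have -> : 12 * (p^-1 / r) * (p * (r ^+ 2 * (r ^+ 2 - 1) / 2))
      = 6 * r * (r ^+ 2 - 1) by field; rewrite !gt_eqF.
    nra.
  apply: (@le_trans _ _ (y ^+ 2 * (12 * (y / r)))).
    apply: ler_pM; rewrite ?exprn_ge0 //.
      by apply: lerXn2r; rewrite ?nnegrE //; lra.
    apply: le_trans eta_le _; rewrite ler_wpM2l // ler_wpM2r // invr_ge0 ltW //.
  have -> : y ^+ 2 * (12 * (y / r)) = 12 * (y ^+ 3 / r) by ring.
  rewrite ler_wpM2l // rE -expRN -expRM_natl -expRD ler_expR; nra.
have ceta_le : c * eta <= tau * (1 - q).
  apply: le_trans keta_le; rewrite ler_wpM2r // cE; nra.
have eta_le : eta <= tau * (1 - q).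
  by apply: le_trans keta_le; rewrite ler_peMl // exprn_ege1.
have tauq_le : tau * (1 - q) <= tau * L by nra.
have T_ge : expR ((2 - 5 * tau) * L) <= T.
  have -> : expR ((2 - 5 * tau) * L) = n%:R ^+ 2 / y ^+ 5.
    by rewrite -nE -!expRM_natl -expRN -expRD; congr expR; ring.
  have -> : T = (g * (4 + eps) * L / (1 - p)) * (n%:R ^+ 2 * (p / kr ^+ 4)).
    by rewrite /T; field; rewrite !gt_eqF //; lra.
  have pk_ge : y ^- 5 <= p / kr ^+ 4.
    rewrite -[leRHS]invrK lef_pV2 ?posrE ?exprn_gt0 ?invr_gt0 ?divr_gt0
      ?exprn_gt0 //; last by lra.
    rewrite invf_div [y ^+ 5]exprS mulrC ler_pM
      ?exprn_ge0 ?invr_ge0 ?(ltW p_gt0) //.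
    by apply: lerXn2r; rewrite ?nnegrE //; lra.
  have fac_ge1 : 1 <= g * (4 + eps) * L / (1 - p).
    rewrite ler_pdivlMr ?subr_gt0 // mul1r.
    have : g0 * L <= g * L by rewrite ler_wpM2r // ltW.
    have : 0 <= g * L * eps by rewrite !mulr_ge0 ?ltW //; lra.
    lra.
  rewrite -[leLHS]mul1r ler_pM ?divr_ge0 ?exprn_ge0 ?(ltW n_gt0) ?(ltW y_gt0) //.
  by rewrite ler_wpM2l // exprn_ge0 // ltW.
have t_gt0 : 0 < t%:R :> R.
  by apply: lt_le_trans le_Tt; apply: lt_le_trans T_ge; exact: expR_gt0.
have lnt_ge : (2 - 5 * tau) * L <= ln t%:R.
  by rewrite -ler_expR lnK ?posrE //; exact: le_trans le_Tt.
have t_ge_n : n%:R <= t%:R :> R.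
  apply: le_trans le_Tt; apply: le_trans T_ge; rewrite -nE ler_expR; nra.
have cN_le : c / (2 * (p * N)) <= c * eta.
  rewrite /eta invfM ler_wpM2l // ler_wpM2r ?invr_ge0 ?(ltW pN_gt0) //.
  have : 1 <= r ^+ 3 by rewrite exprn_ege1 //; lra.
  lra.
(* The constant [4 + eps] enters here: [T k^4 (1 - p) / (4 p n^2)] is exactly [(1 + eps / 4) g L].
   The factor [1 - 2 * tau] pays for replacing [c] by [k^2 / 2]. *)
have main : (1 + eps / 4) * (1 - 2 * tau) * (g * L)
    <= t%:R * c ^+ 2 / (2 * (p * N)) * (1 - p).
  have c2_ge : kr ^+ 4 * (1 - 2 * tau) / 4 <= c ^+ 2.
    have -> : c ^+ 2 = kr ^+ 2 * (kr - 1) ^+ 2 / 4 by rewrite cE; field.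
    rewrite ler_pM2r // (exprD _ 2 2) -mulrA ler_wpM2l ?exprn_ge0 //; nra.
  have N_le : 2 * (p * N) <= p * n%:R ^+ 2.
    rewrite NE -r2 mulrCA ler_wpM2l ?(ltW p_gt0) //; nra.
  have -> : (1 + eps / 4) * (1 - 2 * tau) * (g * L) =
      T * (kr ^+ 4 * (1 - 2 * tau) / 4) / (p * n%:R ^+ 2) * (1 - p).
    by rewrite /T; field; rewrite !gt_eqF //; lra.
  have T_ge0 : 0 <= T by apply: le_trans T_ge; exact: expR_ge0.
  have k4_ge0 : 0 <= kr ^+ 4 * (1 - 2 * tau) / 4.
    by rewrite divr_ge0 // mulr_ge0 ?exprn_ge0 //; lra.
  rewrite ler_wpM2r ?subr_ge0 ?(ltW p_lt1) // ler_pM //.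
  - by rewrite mulr_ge0.
  - by rewrite invr_ge0 mulr_ge0 ?exprn_ge0 // ltW.
  - exact: ler_pM.
  - by rewrite lef_pV2 ?posrE ?mulr_gt0 ?exprn_gt0.
pose M := p * N * (1 + eta).
have ME : M = p * N + 3 * r ^+ 3 by rewrite /M /eta; field; rewrite !gt_eqF.
have M_gt0 : 0 < M by rewrite /M mulr_gt0 //; lra.
have M_le : M <= N.
  rewrite /M mulrAC ler_piMl ?(ltW N_gt0) //.
  have : p * eta <= eta by rewrite ler_piMl // ltW.
  have : tau * (1 - q) <= 1 - q by rewrite ler_piMl; lra.
  lra.
pose s := (t * 'C(k, 2))%N.
pose rho := (M / N) ^+ s * expR (- ('C(s, 2)%:R * (M^-1 - N^-1))).
have rho_ge0 : 0 <= rho.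
  by rewrite mulr_ge0 ?expR_ge0 // exprn_ge0 // divr_ge0 // ltW.
apply: (@le_trans _ _ (Gnp_prob p (fun G : {set {set 'I_n}} =>
    [exists F : {set {set 'I_n}}, clique_packing G k F && (t <= #|F|)%N]))).
  apply: (Gnp_prob_sub p01) => G.
  move=> /existsP[F /andP[packF T_le]].
  by apply/existsP; exists F; rewrite packF t_min.
apply: le_trans (Gnp_prob_packing_le (M := M) (rho := rho) p01 rho_ge0 _) _.
  by move=> m le_mM; exact: ffact_ratio_le.
have tail : Gnp_prob p (fun G : {set {set 'I_n}} => M < #|G|%:R)
    <= expR (- (2 * n%:R)) by rewrite ME; exact: edges_tail_le.
have count : 'C('C(n, k), t)%:R * rho <= expR (- (2 * n%:R)).
  have t_gt0' : (0 < t)%N by rewrite -(ltr0n R).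
  apply: le_trans (packing_count_le t_gt0' le_kn N_gt0 p_gt0 eta_ge0) _.
  rewrite ler_expR -/N -/c gammaE.
  have -> : gamma_exp p n k * ln n%:R = (g + 2) * L by rewrite /g subrK.
  have Xle := @packing_exponent_le _ p eps g g0 tau L N c t%:R eta (ln t%:R).
  have {}Xle : 1 + (g + 2) * L - ln t%:R + c * eta
      - (t%:R * c - 1) * c / 2 * (1 - p - eta) / (p * N)
      <= - (g0 * eps / 16 * L).
    apply: Xle => //; rewrite ?p_gt0 ?eta_ge0 ?g0_gt0 //=; try lra; nra.
  (* With [g0 * eps * L >= 32] each clique contributes at most [-2], and [t >= n]. *)
  apply: le_trans (ler_wpM2l (ltW t_gt0) Xle) _; nra.
apply: le_trans (lerD tail count) _.
have -> : - (2 * n%:R) = - n%:R + - n%:R :> R by ring.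
rewrite expRD -mulrDl ler_piMl ?expR_ge0 // expRN.
have : (expR n%:R)^-1 <= 2^-1 :> R.
  rewrite lef_pV2 ?posrE ?expR_gt0 //; apply: le_trans (expR_ge1Dx _).
  by rewrite lerD2l ler1n (leq_trans _ n_ge4).
lra.
Qed.

(** * Passage to large [n] *)

Theorem theorem1p5 (R : realType) (gamma_minus eps p_plus : R)
    (p gamma : nat -> R) (k : nat -> nat)
    (hgamma_minus : 2 < gamma_minus)
    (heps : 0 < eps < 1) (hp_plus : 0 < p_plus < 1)
    (hLambda : Lambda gamma_minus p_plus p gamma k) :
  exists delta : nat -> R,
    (delta n @[n --> \oo] --> (0 : R))%classic /\
    \forall n \near \oo,
      Gnp_prob (p n)
        (fun G : {set {set 'I_n}} =>
           [exists F : {set {set 'I_n}},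
              clique_packing G (k n) F &&
              (packing_threshold eps (p n) (gamma n) n (k n) <= #|F|%:R)])
      <= expR (- (n%:R `^ (1 + delta n))).
Proof.
(* The bound obtained is [exp(-n)], so the [o(1)] can be taken to be [0]. *)
exists (fun=> 0); split; first exact: cvg_cst.
case: hLambda => hp hlnp hk hgamma hgamma_ge.
have /andP[q_gt0 q_lt1] := hp_plus; have /andP[eps_gt0 eps_lt1] := heps.
pose g0 := gamma_minus - 2; have g0_gt0 : 0 < g0 by rewrite subr_gt0.
pose tau := Num.min (eps / 30) (g0 * eps / 128).
have g0eps_gt0 : 0 < g0 * eps by rewrite mulr_gt0.
have tau_gt0 : 0 < tau by rewrite lt_min !divr_gt0.
have tau_eps : 30 * tau <= eps.
  have : tau <= eps / 30 by rewrite ge_min lexx.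
  lra.
have tau_g0 : 128 * tau <= g0 * eps.
  have : tau <= g0 * eps / 128 by rewrite ge_min lexx orbT.
  lra.
have lnq_lt0 : ln p_plus < 0 by rewrite -ln1 ltr_ln ?posrE.
have L_ge (a : R) : \forall n \near \oo, a <= ln n%:R.
  near=> n; have le_an : expR a <= n%:R by near: n; exact: nbhs_infty_ger.
  by rewrite -ler_expR lnK // posrE (lt_le_trans (expR_gt0 a)).
have small_lnp : \forall n \near \oo, `|ln (p n) / ln n%:R| < tau.
  have /cvgr0Pnorm_lt := hlnp; exact.
pose a := 2 / - ln p_plus.
have a_gt0 : 0 < a by rewrite divr_gt0 ?oppr_gt0.
near=> n.
have hgn : gamma n = gamma_exp (p n) n (k n) by near: n.
have hpn : 0 < p n < p_plus by near: n.
have [pn_gt0 pn_lt] := andP hpn.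
have lnp_lt0 : ln (p n) < 0.
  by rewrite -ln1 ltr_ln ?posrE // (lt_trans pn_lt).
have L_gt0 : 0 < ln n%:R :> R.
  by apply: (@lt_le_trans _ _ 1) => //; near: n; exact: L_ge.
have lnp_le : - ln (p n) <= tau * ln n%:R.
  have : `|ln (p n) / ln n%:R| < tau by near: n.
  rewrite normf_div ltr0_norm // gtr0_norm // ltr_pdivrMr //; exact: ltW.
rewrite addr0 powRr1 // hgn.
apply: (packing_prob_le (tau := tau) (q := p_plus) (g0 := g0)) => //.
- have : gamma_minus <= gamma n by near: n.
  by rewrite hgn /g0 lerD2r.
(* Since [- ln p <= tau log n], the assumption [k >= log n / (- ln p)] gives [k >= 1 / tau]. *)
- have : ln n%:R / ln (p n)^-1 <= (k n)%:R by near: n.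
  rewrite lnV ?posrE // ler_pdivrMr ?oppr_gt0 // => kL.
  rewrite -(ler_pM2r L_gt0) mul1r mulrAC [_ * (k n)%:R]mulrC.
  by apply: le_trans kL _; rewrite ler_wpM2l.
- by near: n; exact: nbhs_infty_ge.
- by rewrite mulrC -ler_pdivrMr //; near: n; exact: L_ge.
- rewrite mulrA mulrC -ler_pdivrMr ?mulr_gt0 //; near: n; exact: L_ge.
- by rewrite mulrC -ler_pdivrMr //; near: n; exact: L_ge.
- rewrite -ler_pdivlMl // -[leRHS]lnK ?posrE ?mulr_gt0 ?subr_gt0 //.
  rewrite ler_expR lerNl ler_pdivlMr //; near: n; exact: L_ge.
(* [exp(tau L) >= (1 + tau L / 2)^2], whose quadratic term dominates [a L] once
   [L >= 4 a / tau^2]. *)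
- have L_big : 4 * a / tau ^+ 2 <= ln n%:R by near: n; exact: L_ge.
  have -> : tau * ln n%:R = tau * ln n%:R / 2 + tau * ln n%:R / 2 by field.
  rewrite expRD -/a; set L := ln n%:R in L_big L_gt0 *.
  have e_ge := expR_ge1Dx (tau * L / 2).
  have tauL_ge0 : 0 <= tau * L / 2 by rewrite divr_ge0 // mulr_ge0 // ltW.
  apply: (@le_trans _ _ ((1 + tau * L / 2) * (1 + tau * L / 2))); last first.
    by rewrite ler_pM // addr_ge0.
  have : a * L <= tau ^+ 2 * L / 4 * L.
    rewrite ler_wpM2r // ?(ltW L_gt0) //.
    by move: L_big; rewrite ler_pdivrMr ?exprn_gt0 //; lra.
  lra.
Unshelve. all: by end_near.
Qed.
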